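(* Let $n\ge 1$ and let $G$ be a group with a subnormal series $$G=G_1\triangleright G_2\triangleright\ldots\triangleright G_n\triangleright G_{n+1}=\{1\}$$ in which all factors $G_i/G_{i+1}$ are abelian and all factors except possibly the last one $G_n/G_{n+1}$ are torsion-free. Then there is a group $\tilde G\supset G$ with a subnormal series $$\tilde G=\tilde G_1\triangleright\tilde G_2\triangleright\ldots\triangleright\tilde G_n\triangleright\tilde G_{n+1}=\{1\}$$ of the same length, in which all factors are abelian and all factors except possibly the last one are torsion-free, such that $\tilde G$ contains a solution of every non-singular system of equations over $G$, and even of every non-singular system of equations over $\tilde G$.
   Context: Systems of equations. Let $G$ be a group and $X=\{x_i\}_{i\in I}$ a (finite or infinite) set of variables; $F(X)$ is the free group with basis $X$. A system of equations over $G$ in variables $X$ is a (finite or infinite) family $\{w_j=1\}_{j\in J}$ with $w_j\in G*F(X)$ (free product). It has a solution in a group $\tilde G\supset G$ if there are elements $\tilde g_i\in\tilde G$ ($i\in I$) such that substituting $x_i\mapsto\tilde g_i$ (and keeping elements of $G$ fixed) turns every $w_j$ into $1$. The system is called non-singular if the images of the words $w_j$, $j\in J$, under the homomorphism $G*F(X)\to\bigoplus_{i\in I}\mathbb Z\, x_i$ that sends $G$ to $0$ and each $x_i$ to the basis element $x_i$ (i.e. the rows of exponent sums of the variables in $w_j$) form a family linearly independent over $\mathbb Z$. *)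

(* Defs.v *)
(* MathComp, with the classical layer of MathComp-Analysis for the
   Prop-valued sets [set T] and for the decidability of word equivalence. *)
From HB Require Import structures.
From mathcomp Require Import all_boot all_order all_algebra.
From mathcomp Require Import boolp classical_sets.
From mathcomp Require Import freeg.

Set Implicit Arguments.
Unset Strict Implicit.
Unset Printing Implicit Defensive.

Import GRing.Theory.

Local Open Scope classical_set_scope.
Local Open Scope group_scope.
Local Open Scope quotient_scope.

(* Group homomorphisms: between groups, a unital multiplicative map. *)
Notation "{ 'hom' G -> H }" := (UMagmaMorphism.type G H)
  (at level 0, G at level 98, H at level 99, format "{ 'hom'  G  ->  H }").

Section FreeProduct.
Variables (G : groupType) (I : choiceType).

(* [inl g] is the letter g of G; [inr (i, false)] and [inr (i, true)] are the
   letters x_i and x_i^-1. *)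
Definition letter := (G + I * bool)%type.
Definition word := seq letter.

Inductive word_equiv : word -> word -> Prop :=
| WordRefl u : word_equiv u u
| WordSym u v : word_equiv u v -> word_equiv v u
| WordTrans v u w : word_equiv u v -> word_equiv v w -> word_equiv u w
| WordOne a b : word_equiv (a ++ inl 1 :: b) (a ++ b)
| WordMul a b g h :
    word_equiv (a ++ inl g :: inl h :: b) (a ++ inl (g * h) :: b)
| WordCancel a b i e :
    word_equiv (a ++ inr (i, e) :: inr (i, ~~ e) :: b) (a ++ b).

Definition word_eqb : rel word := fun u v => `[< word_equiv u v >].

Lemma word_eqb_refl : reflexive word_eqb.
Proof. by move=> u; apply/asboolP/WordRefl. Qed.

Lemma word_eqb_sym : symmetric word_eqb.
Proof. by move=> u v; apply/asboolP/asboolP => /WordSym. Qed.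

Lemma word_eqb_trans : transitive word_eqb.
Proof.
move=> v u w /asboolP uv /asboolP vw; apply/asboolP.
exact: WordTrans uv vw.
Qed.

Canonical word_equiv_rel :=
  EquivRel word_eqb word_eqb_refl word_eqb_sym word_eqb_trans.

(* The free product G * F(X), with X = {x_i | i : I}. *)
Definition freeprod := {eq_quot word_eqb}.
HB.instance Definition _ := Choice.on freeprod.
HB.instance Definition _ := Quotient.on freeprod.
HB.instance Definition _ := EqQuotient.on freeprod.

Lemma freeprod_eqP u v :
  \pi_freeprod u = \pi_freeprod v <-> word_equiv u v.
Proof.
split=> [/eqP|uv]; first by rewrite eqmodE => /asboolP.
by apply/eqP; rewrite eqmodE; apply/asboolP.
Qed.

Lemma freeprod_reprP u : word_equiv (repr (\pi_freeprod u)) u.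
Proof. by apply/freeprod_eqP; rewrite reprK. Qed.

Lemma word_equiv_catl c u v : word_equiv u v -> word_equiv (c ++ u) (c ++ v).
Proof.
elim=> {u v} [u|u v _ uv|v u w _ uv _ vw|a b|a b g h|a b i e].
- exact: WordRefl.
- exact: WordSym.
- exact: WordTrans uv vw.
- by rewrite !catA; apply: WordOne.
- by rewrite !catA; apply: WordMul.
- by rewrite !catA; apply: WordCancel.
Qed.

Lemma word_equiv_catr c u v : word_equiv u v -> word_equiv (u ++ c) (v ++ c).
Proof.
elim=> {u v} [u|u v _ uv|v u w _ uv _ vw|a b|a b g h|a b i e].
- exact: WordRefl.
- exact: WordSym.
- exact: WordTrans uv vw.
- by rewrite -!catA /=; apply: WordOne.
- by rewrite -!catA /=; apply: WordMul.
- by rewrite -!catA /=; apply: WordCancel.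
Qed.

Definition letter_inv (l : letter) : letter :=
  match l with inl g => inl g^-1 | inr (i, e) => inr (i, ~~ e) end.

Definition word_inv (u : word) : word := rev (map letter_inv u).

Lemma word_inv_cat u v : word_inv (u ++ v) = word_inv v ++ word_inv u.
Proof. by rewrite /word_inv map_cat rev_cat. Qed.

Lemma word_inv_cons l u : word_inv (l :: u) = word_inv u ++ [:: letter_inv l].
Proof. by rewrite /word_inv /= rev_cons -cats1. Qed.

Lemma word_invK : involutive word_inv.
Proof.
move=> u; rewrite /word_inv map_rev revK -map_comp -[RHS]map_id.
by apply: eq_map => -[g|[i e]] /=; rewrite ?invgK ?negbK.
Qed.

Lemma word_equiv_inv u v :
  word_equiv u v -> word_equiv (word_inv u) (word_inv v).
Proof.
elim=> {u v} [u|u v _ uv|v u w _ uv _ vw|a b|a b g h|a b i e].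
- exact: WordRefl.
- exact: WordSym.
- exact: WordTrans uv vw.
- rewrite !word_inv_cat word_inv_cons /= invg1 -catA; exact: WordOne.
- rewrite !word_inv_cat !word_inv_cons /= invgM -!catA; exact: WordMul.
- rewrite !word_inv_cat !word_inv_cons /= -!catA /= negbK; exact: WordCancel.
Qed.

Lemma word_equiv_letterV l : word_equiv [:: letter_inv l; l] [::].
Proof.
case: l => [g|[i e]] /=.
  apply: (WordTrans (WordMul [::] [::] _ _)); rewrite mulVg.
  exact: (WordOne [::] [::]).
by have := WordCancel [::] [::] i (~~ e); rewrite negbK.
Qed.

Lemma word_equiv_mulV u : word_equiv (word_inv u ++ u) [::].
Proof.
elim: u => [|l u IHu]; first exact: WordRefl.
rewrite word_inv_cons -catA; apply: WordTrans IHu.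
apply: word_equiv_catl; exact: (word_equiv_catr u (word_equiv_letterV l)).
Qed.

Definition freeprod_one : freeprod := \pi_freeprod [::].
Definition freeprod_mul (p q : freeprod) : freeprod :=
  \pi_freeprod (repr p ++ repr q).
Definition freeprod_inv (p : freeprod) : freeprod :=
  \pi_freeprod (word_inv (repr p)).

Lemma freeprod_mulE u v :
  freeprod_mul (\pi_freeprod u) (\pi_freeprod v) = \pi_freeprod (u ++ v).
Proof.
apply/freeprod_eqP; apply: (@WordTrans (u ++ repr (\pi_freeprod v))).
  exact/word_equiv_catr/freeprod_reprP.
exact/word_equiv_catl/freeprod_reprP.
Qed.

Lemma freeprod_invE u :
  freeprod_inv (\pi_freeprod u) = \pi_freeprod (word_inv u).
Proof. exact/freeprod_eqP/word_equiv_inv/freeprod_reprP. Qed.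

Lemma freeprod_mulA : associative freeprod_mul.
Proof.
elim/quotW=> u; elim/quotW=> v; elim/quotW=> w.
by rewrite (freeprod_mulE u v) (freeprod_mulE v w) !freeprod_mulE catA.
Qed.

Lemma freeprod_mul1 : left_id freeprod_one freeprod_mul.
Proof. by move=> p; rewrite -[p]reprK freeprod_mulE. Qed.

Lemma freeprod_mulr1 : right_id freeprod_one freeprod_mul.
Proof. by move=> p; rewrite -[p]reprK freeprod_mulE cats0. Qed.

Lemma freeprod_mulV : left_inverse freeprod_one freeprod_inv freeprod_mul.
Proof.
move=> p; rewrite -[p]reprK freeprod_invE freeprod_mulE.
exact/freeprod_eqP/word_equiv_mulV.
Qed.

Lemma freeprod_mulrV : right_inverse freeprod_one freeprod_inv freeprod_mul.
Proof.
move=> p; rewrite -[p]reprK freeprod_invE freeprod_mulE.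
apply/freeprod_eqP; rewrite -[X in X ++ _]word_invK.
exact: word_equiv_mulV.
Qed.

HB.instance Definition _ := isGroup.Build freeprod
  freeprod_mulA freeprod_mul1 freeprod_mulr1 freeprod_mulV freeprod_mulrV.

Definition fp_const (g : G) : freeprod := \pi_freeprod [:: inl g].
Definition fp_var (i : I) : freeprod := \pi_freeprod [:: inr (i, false)].

Lemma fp_pi_cat u v :
  \pi_freeprod (u ++ v) = \pi_freeprod u * \pi_freeprod v.
Proof. by rewrite -freeprod_mulE. Qed.

Lemma fp_pi_nil : \pi_freeprod [::] = 1.
Proof. by []. Qed.

Lemma fp_constM g h : fp_const (g * h) = fp_const g * fp_const h.
Proof.
rewrite /fp_const -fp_pi_cat; apply/freeprod_eqP/WordSym.
exact: (WordMul [::] [::]).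
Qed.

Lemma fp_const1 : fp_const 1 = 1.
Proof. apply/freeprod_eqP; exact: (WordOne [::] [::]). Qed.

HB.instance Definition _ := isUMagmaMorphism.Build G freeprod fp_const
  (conj fp_const1 fp_constM).

Lemma fp_pi_var i e :
  \pi_freeprod [:: inr (i, e)] = if e then (fp_var i)^-1 else fp_var i.
Proof. by case: e => //; rewrite /fp_var; symmetry; apply: freeprod_invE. Qed.

(* The homomorphism G * F(X) -> H given by phi : G -> H and x_i |-> x i. *)
Section Substitution.
Variables (H : groupType) (phi : {hom G -> H}) (x : I -> H).

Definition letter_val (l : letter) : H :=
  match l with
  | inl g => phi g
  | inr (i, e) => if e then (x i)^-1 else x i
  end.

Definition word_val (u : word) : H := \prod_(l <- u) letter_val l.

Lemma word_val_equiv u v : word_equiv u v -> word_val u = word_val v.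
Proof.
rewrite /word_val.
elim=> {u v} [u|u v _ ->|v u w _ -> _ ->|a b|a b g h|a b i e] //.
- by rewrite !big_cat big_cons /= gmulf1 mul1g.
- by rewrite !big_cat !big_cons /= gmulfM !mulgA.
- rewrite !big_cat !big_cons /=; congr (_ * _); rewrite mulgA.
  by case: e; rewrite ?mulVg ?mulgV mul1g.
Qed.

Definition fp_subst (p : freeprod) : H := word_val (repr p).

Lemma fp_substE u : fp_subst (\pi_freeprod u) = word_val u.
Proof. exact/word_val_equiv/freeprod_reprP. Qed.

Lemma fp_subst1 : fp_subst 1 = 1.
Proof. by rewrite -fp_pi_nil fp_substE /word_val big_nil. Qed.

Lemma fp_substM : {morph fp_subst : p q / p * q}.
Proof.
move=> p q; rewrite -[p]reprK -[q]reprK -fp_pi_cat !fp_substE.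
by rewrite /word_val big_cat.
Qed.

HB.instance Definition _ := isUMagmaMorphism.Build freeprod H fp_subst
  (conj fp_subst1 fp_substM).

Lemma fp_subst_const g : fp_subst (fp_const g) = phi g.
Proof. by rewrite fp_substE /word_val big_seq1. Qed.

Lemma fp_subst_var i : fp_subst (fp_var i) = x i.
Proof. by rewrite fp_substE /word_val big_seq1. Qed.

Lemma fp_subst_unique (f : {hom freeprod -> H}) :
  (forall g, f (fp_const g) = phi g) -> (forall i, f (fp_var i) = x i) ->
  f =1 fp_subst.
Proof.
move=> fG fX p; rewrite -[p]reprK; elim: (repr p) => [|l u IHu].
  by rewrite fp_pi_nil !gmulf1.
rewrite -cat1s fp_pi_cat !gmulfM IHu; congr (_ * _).
case: l => [g|[i e]]; first by rewrite [LHS]fG -fp_subst_const.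
rewrite fp_pi_var; have fsX: f (fp_var i) = fp_subst (fp_var i).
  by rewrite fX fp_subst_var.
by case: e; rewrite ?gmulfV fsX.
Qed.

End Substitution.

Local Open Scope ring_scope.

(* The homomorphism from G * F(X) to the free abelian group {freeg I / int}
   that kills G and sends x_i to the basis element << i >>. *)
Definition letter_expsum (l : letter) : {freeg I / int} :=
  match l with
  | inl _ => 0
  | inr (i, e) => if e then - << i >> else << i >>
  end.

Definition word_expsum (u : word) : {freeg I / int} :=
  \sum_(l <- u) letter_expsum l.

Lemma word_expsum_equiv u v : word_equiv u v -> word_expsum u = word_expsum v.
Proof.
rewrite /word_expsum.
elim=> {u v} [u|u v _ ->|v u w _ -> _ ->|a b|a b g h|a b i e] //.
- by rewrite !big_cat big_cons /= add0r.
- by rewrite !big_cat !big_cons /= add0r.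
- rewrite !big_cat !big_cons /=; congr (_ + _); rewrite addrA.
  by case: e; rewrite ?addNr ?addrN add0r.
Qed.

Definition fp_expsum (p : freeprod) : {freeg I / int} := word_expsum (repr p).

Lemma fp_expsumE u : fp_expsum (\pi_freeprod u) = word_expsum u.
Proof. exact/word_expsum_equiv/freeprod_reprP. Qed.

Lemma fp_expsum1 : fp_expsum 1%g = 0.
Proof. by rewrite -fp_pi_nil fp_expsumE /word_expsum big_nil. Qed.

Lemma fp_expsumM p q : fp_expsum (p * q)%g = fp_expsum p + fp_expsum q.
Proof.
rewrite -[p]reprK -[q]reprK -fp_pi_cat !fp_expsumE.
by rewrite /word_expsum big_cat.
Qed.

Lemma fp_expsum_const g : fp_expsum (fp_const g) = 0.
Proof. by rewrite fp_expsumE /word_expsum big_seq1. Qed.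

Lemma fp_expsum_var i : fp_expsum (fp_var i) = << i >>.
Proof. by rewrite fp_expsumE /word_expsum big_seq1. Qed.

End FreeProduct.

(* A family, so that repeated vectors are dependent. *)
Definition Z_independent (V : zmodType) (J : choiceType) (v : J -> V) : Prop :=
  forall (s : seq J) (c : J -> int), uniq s ->
    (\sum_(j <- s) v j *~ c j = 0)%R -> forall j, j \in s -> c j = 0%R.

(* A system {w_j = 1} over G in the variables indexed by I is a family
   w : J -> freeprod G I. *)
Definition nonsingular (G : groupType) (I J : choiceType)
    (w : J -> freeprod G I) : Prop :=
  Z_independent (fun j => fp_expsum (w j)).

(* The overgroup H of G is given by the homomorphism phi. *)
Definition has_solution (G H : groupType) (phi : {hom G -> H})
    (I J : choiceType) (w : J -> freeprod G I) : Prop :=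
  exists x : I -> H, forall j, fp_subst phi x (w j) = 1.

Section Series.
Variable G : groupType.
Implicit Types (H K : set G).

Definition subgroup_set H : Prop :=
  [/\ H 1, forall x y, H x -> H y -> H (x * y) & forall x, H x -> H x^-1].

Definition normal_in H K : Prop :=
  H `<=` K /\ forall h k, H h -> K k -> H (h ^ k).

Definition left_coset (x : G) H : set G := [set x * h | h in H].

(* For H normal in K, the elements of K/H are the cosets xH with x in K, the
   product of xH and yH is (xy)H, and the identity is H. *)
Definition abelian_factor K H : Prop :=
  forall x y, K x -> K y -> left_coset (x * y) H = left_coset (y * x) H.

Definition torsion_free_factor K H : Prop :=
  forall x (m : nat), K x -> (0 < m)%N ->
    left_coset (x ^+ m) H = H -> left_coset x H = H.

(* S 1, ..., S n.+1 are the terms of the series; the other values of S are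
   irrelevant. *)
Definition abelian_tf_series (n : nat) (S : nat -> set G) : Prop :=
  [/\ S 1%N = [set: G] /\ S n.+1 = [set 1],
      forall i, (1 <= i <= n.+1)%N -> subgroup_set (S i),
      forall i, (1 <= i <= n)%N -> normal_in (S i.+1) (S i),
      forall i, (1 <= i <= n)%N -> abelian_factor (S i) (S i.+1)
    & forall i, (1 <= i < n)%N -> torsion_free_factor (S i) (S i.+1)].

End Series.

(* Main.v *)
(* Write N = G_2 and B = G/N. The proof is by induction on n. By induction N
   embeds in a group H with a series of length n - 1 over which every
   non-singular system is solvable, and B embeds in a power V of Q (of Q/Z when
   n = 1, with H trivial), so G embeds in the unrestricted wreath product H Wr V
   (Kaloujnine-Krasner). Given a non-singular system over H Wr V, its image in V
   is solvable because V is divisible, hence injective. Fixing such a solution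
   v, each unknown becomes x_i = (y_i, v_i) with y_i : V -> H free, and the
   system turns into one over H with unknowns y_i(u), indexed by I * V, and
   equations indexed by J * V.

   This last system is non-singular when V is torsion-free. Take a relation
   sum c_(j,u) e_(j,u) = 0 between its exponent rows and an additive
   f : V -> Q that is injective on the finitely many u involved. For a
   polynomial p over Q put m_j(p) = sum_u c_(j,u) p(f u). Weighting the unknown
   (i, u) by p(f u), and using that p(X - s) - p(X) has smaller degree than p,
   one gets sum_j m_j(p) e_j = 0 as soon as all m_j vanish on smaller degrees,
   where e_j is the exponent row of the original equation; so m_j(p) = 0 for all
   p by induction on the degree, and Lagrange interpolation gives c = 0. *)
Require Import Defs.
From HB Require Import structures.
From mathcomp Require Import all_boot all_order all_algebra.
From mathcomp Require Import boolp classical_sets functions.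
From mathcomp Require Import freeg ring.

Set Implicit Arguments.
Unset Strict Implicit.
Unset Printing Implicit Defensive.

Import Order.TTheory GRing.Theory Num.Theory.

Local Open Scope classical_set_scope.
Local Open Scope group_scope.
Local Open Scope quotient_scope.
Local Open Scope ring_scope.

(** * Divisible groups are injective *)

Definition divisible (A : zmodType) : Prop :=
  forall (n : nat) (a : A), (0 < n)%N -> exists b, b *+ n = a.

Definition torsion_free (A : zmodType) : Prop :=
  forall (n : nat) (a : A), (0 < n)%N -> a *+ n = 0 -> a = 0.

Section Extension.
Variables F A : zmodType.

(** A homomorphism from a subgroup of [F] to [A] is encoded by its graph, a subgroup of the product;
    the third clause makes the graph single-valued. *)
Definition partial_hom (M : set (F * A)) : Prop :=
  [/\ M 0, forall p q, M p -> M q -> M (p - q) & forall a, M (0, a) -> a = 0].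

Lemma partial_homD M p q : partial_hom M -> M p -> M q -> M (p + q).
Proof.
move=> [M0 MB _] Mp Mq; rewrite -[q]opprK -[- q]add0r.
exact: MB _ _ Mp (MB _ _ M0 Mq).
Qed.

Lemma partial_homMz M p (k : int) : partial_hom M -> M p -> M (p *~ k).
Proof.
move=> hM Mp; have [M0 MB _] := hM.
have MN q : M q -> M (- q) by move=> Mq; rewrite -sub0r; apply: MB.
have Mn n : M (p *+ n).
  by elim: n => [|n IH]; rewrite ?mulr0n // mulrS; apply: partial_homD.
by case: k => n; rewrite ?NegzE ?mulrNz; [|apply: MN]; apply: Mn.
Qed.

(** If (0, b) = (y, c) + k(x, a) with (y, c) in [M], then (k x, -c) lies in [M], so the hypothesis
    gives -c = k a and hence b = 0. *)
Lemma partial_hom_add M x a :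
    partial_hom M ->
    (forall k (b : A), M (x *~ k, b) -> b = a *~ k) ->
  partial_hom [set p | exists2 q, M q & exists k : int, p = q + (x, a) *~ k].
Proof.
move=> hM Mxa; have [M0 MB M1] := hM; split.
- by exists 0 => //; exists 0; rewrite mulr0z addr0.
- move=> _ _ [p Mp [k ->]] [q Mq [l ->]]; exists (p - q); first exact: MB.
  by exists (k - l); rewrite mulrzBr opprD addrACA.
- move=> b [[y c] Myc [k [e1 e2]]].
  have kE : ((x, a) *~ k : F * A) = (x *~ k, a *~ k).
    by rewrite [LHS]surjective_pairing (raddfMz fst) (raddfMz snd).
  move: e1 e2; rewrite kE /= => e1 ->.
  have Mk : M (x *~ k, - c).
    have := MB _ _ M0 Myc; congr M; congr pair => /=; rewrite sub0r //.
    by apply/eqP; rewrite eq_sym -addr_eq0 addrC -e1.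
  by rewrite -(Mxa _ _ Mk) addrN.
Qed.

Hypothesis divA : divisible A.

(** Let n be the least positive integer with n x in the domain of [M]. Every k with k x in the
    domain is a multiple of n, so it is enough to divide the value at n x by n. If there is no such
    n, only k = 0 occurs and a = 0 works. *)
Lemma partial_hom_step M x :
  partial_hom M -> exists a, forall k (b : A), M (x *~ k, b) -> b = a *~ k.
Proof.
move=> hM; have [M0 MB M1] := hM.
have Muniq y b c : M (y, b) -> M (y, c) -> b = c.
  move=> Mb Mc; have := MB _ _ Mb Mc.
  have -> : ((y, b) - (y, c) : F * A) = (0, b - c).
    by congr pair => /=; rewrite subrr.
  by move/M1/subr0_eq.
pose P n := (0 < n)%N && `[< exists b, M (x *+ n, b) >].
have PE n : (0 < n)%N -> (exists b, M (x *+ n, b)) -> P n.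
  by move=> n0 ex; rewrite /P n0; apply/asboolP.
have MzE z (c : A) k : M (z, c) -> M (z *~ k, c *~ k).
  move=> Mz; have := partial_homMz k hM Mz; congr M.
  by rewrite [LHS]surjective_pairing (raddfMz fst) (raddfMz snd).
have absP k b : M (x *~ k, b) -> k != 0 -> P `|k|%N.
  move=> Mk k0; apply: PE; first by rewrite absz_gt0.
  exists (b *~ sgz k); have := MzE _ _ (sgz k) Mk.
  by rewrite -mulrzA mulrC -abszEsg.
have [exP|nP] := pselect (exists n, P n); last first.
  exists 0 => k b Mk; have [k0|k0] := eqVneq k 0; last first.
    by case: nP; exists `|k|%N; apply: absP Mk k0.
  by move: Mk; rewrite k0 !mulr0z => /M1.
case: (ex_minnP exP) => n /andP[n0 /asboolP[b Mb]] nmin.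
have [a ab] := divA b n0; exists a => k c Mk.
(* Otherwise the remainder of |k| modulo n would be a smaller positive multiplier, against the
   choice of n. *)
have nk : (n %| `|k|)%N.
  have [r0|r0] := posnP (`|k| %% n)%N; first by rewrite /dvdn r0.
  have := ltn_pmod `|k| n0; rewrite ltnNge => /negP[]; apply: nmin; apply: PE => //.
  have [d Md] : exists d, M (x *+ `|k|, d).
    have [->|k0] := eqVneq k 0; first by exists 0; rewrite mulr0n.
    by have /andP[_ /asboolP] := absP _ _ Mk k0.
  exists (d - b *~ (`|k| %/ n)%N).
  have := MB _ _ Md (MzE _ _ (`|k| %/ n)%N Mb); congr M; congr pair => /=.
  by rewrite -pmulrn -mulrnA {1}(divn_eq `|k| n) mulrnDr mulnC addrC addKr.
have /dvdzP[q kE] : (n%:Z %| k)%Z by rewrite dvdzE.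
apply: (Muniq _ _ _ Mk); rewrite kE mulrC !mulrzA -!pmulrn ab.
exact: MzE.
Qed.

(** Baer's argument: Zorn's lemma gives a maximal partial homomorphism containing [M], and
    [partial_hom_step] forces its domain to be all of [F]. *)
Lemma hom_extend (M : set (F * A)) :
  partial_hom M -> exists f : {additive F -> A}, forall p, M p -> f p.1 = p.2.
Proof.
(* Zorn's lemma is applied to the sets X whose union with [M] is a partial homomorphism, so that the
   empty chain causes no trouble. *)
move=> hM; have [|B [hB Bmax]] := @Zorn_bigcup _ (fun X => partial_hom (M `|` X)).
  move=> C CP Ctot; have [M0 MB M1] := hM.
  split; first by left.
  - have MC X : C X -> M `|` X `<=` M `|` \bigcup_(Y in C) Y.
      by move=> CX z [|] ?; [left|right; exists X].
    move=> p q [Mp|[X CX Xp]] [Mq|[Y CY Yq]].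
    + by left; apply: MB.
    + by apply: (MC _ CY); have [_ + _] := CP _ CY; apply; [left|right].
    + by apply: (MC _ CX); have [_ + _] := CP _ CX; apply; [right|left].
    + have [XY|YX] := Ctot _ _ CX CY.
        by apply: (MC _ CY); have [_ + _] := CP _ CY; apply; right => //; apply: XY.
      by apply: (MC _ CX); have [_ + _] := CP _ CX; apply; right => //; apply: YX.
  - by move=> a [/M1//|[X CX Xa]]; have [_ _] := CP _ CX; apply; right.
have [N0 NB N1] := hB; set N := M `|` B in hB N0 NB N1.
have total x : exists a, N (x, a).
  have [a aP] := partial_hom_step x hB.
  have hN' := partial_hom_add hB aP; set N' := [set _ | _] in hN'.
  have NN' : N `<=` N' by move=> p Np; exists p => //; exists 0; rewrite mulr0z addr0.
  have N'x : N' (x, a) by exists 0 => //; exists 1; rewrite mulr1z add0r.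
  have [//|nN] := pselect (N (x, a)); first by exists a.
  case: (Bmax N'); last first.
    by rewrite setUidr // => z Mz; apply: NN'; left.
  split=> [z Bz|sub]; first by apply: NN'; right.
  by case: nN; right; apply: sub.
have [f fP] := choice total.
have fB : zmod_morphism f.
  move=> x y; apply/subr0_eq/N1.
  have := NB _ _ (fP (x - y)) (NB _ _ (fP x) (fP y)); congr N.
  by congr pair => /=; rewrite subrr.
pose fA := GRing.isZmodMorphism.Build _ _ f fB.
pose g : {additive F -> A} := HB.pack f fA.
exists g => -[x a] Mxa /=.
apply/subr0_eq/N1; have := NB _ _ (fP x) (or_introl Mxa); congr N.
by congr pair => /=; rewrite subrr.
Qed.

End Extension.

Section IntegralLift.
Variables (J : choiceType) (F : zmodType) (e : J -> F).

(** [zmodule F] is [F] seen as a module over the integers, as [fglift] expects. *)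
Definition zlift (D : {freeg J / int}) : F := fglift (e : J -> zmodule F) D.

Lemma zlift_is_zmod_morphism : zmod_morphism zlift.
Proof. exact: (@lift_is_additive int J (zmodule F) e). Qed.

HB.instance Definition _ := GRing.isZmodMorphism.Build {freeg J / int} F zlift
  zlift_is_zmod_morphism.

Lemma zliftZ k j : zlift << k *g j >> = e j *~ k.
Proof. exact: (@liftU int (zmodule F)). Qed.

Lemma zliftU j : zlift << j >> = e j.
Proof. by rewrite zliftZ mulr1z. Qed.

Lemma zliftE D : zlift D = \sum_(j <- dom D) e j *~ coeff j D.
Proof.
by rewrite -{1}[D]freeg_sumE raddf_sum; apply: eq_bigr => j _; apply: zliftZ.
Qed.

Lemma zlift_eq0 D : Z_independent e -> zlift D = 0 -> D = 0.
Proof.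
rewrite zliftE => e_ind D0; rewrite -[D]freeg_sumE big1_seq // => j /andP[_ Dj].
by rewrite (e_ind _ _ (uniq_dom D) D0 _ Dj) freegU0.
Qed.

End IntegralLift.

(** Independence makes the assignment of c_j to e_j well defined on the span of the e_j, and
    divisibility extends it to [F]. This is how the image of a system in V gets solved. *)
Lemma independent_extend (J : choiceType) (F A : zmodType) (e : J -> F)
    (c : J -> A) :
    divisible A -> Z_independent e ->
  exists f : {additive F -> A}, forall j, f (e j) = c j.
Proof.
move=> divA e_ind.
have [|f fP] := @hom_extend F A divA [set p | exists D, p = (zlift e D, zlift c D)].
  split.
  - by exists 0; rewrite !raddf0.
  - by move=> _ _ [D ->] [D' ->]; exists (D - D'); rewrite !raddfB.
  - by move=> a [D [/esym/(zlift_eq0 e_ind) -> ->]]; rewrite raddf0.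
exists f => j; have /= := fP (e j, c j); apply; exists << j >>.
by rewrite !zliftU.
Qed.

(** * Embedding abelian groups in powers of Q and Q/Z *)

Definition separated_by (A0 A : zmodType) : Prop :=
  forall a : A, a != 0 -> exists f : {additive A -> A0}, f a != 0.

Lemma divisible_rat : divisible rat.
Proof.
move=> n a n0; exists (a / n%:R).
by rewrite -[LHS]mulr_natr mulfVK // pnatr_eq0 -lt0n.
Qed.

Lemma torsion_free_rat : torsion_free rat.
Proof.
by move=> n a n0 /eqP; rewrite mulrn_eq0 eqn0Ngt n0 => /eqP.
Qed.

(** A nonzero element of a torsion-free group is an independent family of size one, so a map sending
    it to 1 extends to [A]. *)
Lemma torsion_free_separated (A : zmodType) :
  torsion_free A -> separated_by rat A.
Proof.
move=> tfA a a0.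
have tfz k : a *~ k = 0 -> k = 0.
  move=> ak0; apply/eqP; apply: contraNT a0 => k0; apply/eqP.
  apply: (tfA `|k|%N); first by rewrite absz_gt0.
  by rewrite pmulrn abszEsg mulrC mulrzA ak0 mul0rz.
have [|f fa] := @independent_extend unit A rat (fun=> a) (fun=> 1) divisible_rat.
  move=> s c us s0 [] ss; move: s0.
  have -> : s = [:: tt].
    by case: s us ss => [|[] [|[] s]].
  by rewrite big_seq1; apply: tfz.
by exists f; rewrite (fa tt).
Qed.

Section Evaluation.
Variables (A0 A : zmodType).

Lemma divisible_fun (X : Type) : divisible A0 -> divisible (X -> A0).
Proof.
move=> divA n f n0; have [g gP] := choice (fun x => divA n (f x) n0).
by exists g; apply/funext => x; rewrite natmulfctE.
Qed.

Lemma torsion_free_fun (X : Type) : torsion_free A0 -> torsion_free (X -> A0).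
Proof.
move=> tfA n f n0 fn0; apply/funext => x; apply: (tfA n) => //.
have -> : f x *+ n = (f *+ n) x by rewrite natmulfctE.
  by rewrite fn0.
Qed.

(** The coordinates run over all functions from [A] to [A0], so that the target is a plain power;
    the coordinate at a non-additive function is set to 0. *)
Lemma eval_embedding :
  separated_by A0 A -> exists f : {additive A -> (A -> A0) -> A0}, injective f.
Proof.
move=> sep.
pose ev (a : A) (g : A -> A0) := if `[< zmod_morphism g >] then g a else 0.
have evB : zmod_morphism ev.
  move=> a b; apply/funext => g; rewrite /ev [RHS]/=.
  change (ev (a - b) g = ev a g - ev b g); rewrite /ev.
  case: asboolP => [gB|_]; first exact: gB. by rewrite subr0.
pose evA := GRing.isZmodMorphism.Build _ _ ev evB.
pose f : {additive A -> (A -> A0) -> A0} := HB.pack ev evA.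
exists f => a b fab; apply/subr0_eq/eqP/negPn/negP => /sep [g gab].
have : f (a - b) = 0 by rewrite raddfB fab subrr.
move/(congr1 (@^~ (g : A -> A0))); rewrite /f /= /ev asboolT; last exact: raddfB.
by move/eqP: gab.
Qed.

End Evaluation.


Definition rat_int : {pred rat} := [pred x : rat | x \is a Num.int].

Lemma rat_int_zmod_closed : zmod_closed rat_int.
Proof. by split=> [|x y]; rewrite !inE ?rpred0 //; apply: rpredB. Qed.

HB.instance Definition _ := GRing.isZmodClosed.Build rat rat_int rat_int_zmod_closed.

Definition rat_mod_int : zmodType := Quotient.quot rat_int.

Lemma rat_mod_int_eq0 (x : rat) :
  \pi_(rat_mod_int)%qT x = 0 <-> exists k : int, x = k%:~R.
Proof.
have -> : (0 : rat_mod_int) = \pi_rat_mod_int%qT 0 by rewrite raddf0.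
split=> [/eqP|[k ->]].
  rewrite -Quotient.idealrBE subr0 => /intrP[k ->]; by exists k.
by apply/eqP; rewrite -Quotient.idealrBE subr0; apply/intrP; exists k.
Qed.

Lemma divisible_rat_mod_int : divisible rat_mod_int.
Proof.
move=> n; elim/quotW=> x n0; have [y <-] := divisible_rat x n0.
by exists (\pi_rat_mod_int%qT y); rewrite raddfMn.
Qed.

Lemma separated_rat_mod_int (A : zmodType) : separated_by rat_mod_int A.
Proof.
move=> a a0.
(* A nonzero t killed by every integer that kills a makes a |-> t well defined on the cyclic group
   of a. Take t = 1/n if a has finite order n, and t = 1/2 if a has infinite order. *)
have [t [t0 tP]] : exists t : rat_mod_int, t != 0 /\
    forall k : int, a *~ k = 0 -> t *~ k = 0.
  pose P n := (0 < n)%N && (a *+ n == 0).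
  pose pi := (\pi_rat_mod_int%qT : {additive rat -> rat_mod_int}).
  have piq (n : nat) : (1 < n)%N -> pi n%:R^-1 != 0.
    move=> n1; apply/eqP => /rat_mod_int_eq0 [k kE].
    have : (k%:~R : rat) * n%:R = 1 by rewrite -kE mulVf // pnatr_eq0 -lt0n ltnW.
    rewrite [n%:R]pmulrn -intrM => /(@intr_inj _ _ 1) kn.
    have := congr1 absz kn.
    by rewrite abszM /= => /eqP; rewrite muln_eq1 => /andP[_]; rewrite gtn_eqF.
  have [exP|nP] := pselect (exists n, P n); last first.
    exists (pi 2%:R^-1); split=> [|k ak0]; first exact: piq.
    have [->|k0] := eqVneq k 0; first by rewrite mulr0z.
    case: nP; exists `|k|%N; rewrite /P absz_gt0 k0 /=.
    by rewrite pmulrn abszEsg mulrC mulrzA ak0 mul0rz.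
  case: (ex_minnP exP) => n /andP[n0 /eqP an] nmin.
  exists (pi n%:R^-1); split=> [|k ak0].
    apply: piq; rewrite ltn_neqAle eq_sym n0 andbT.
    by apply: contraNneq a0 => n1; rewrite -an n1.
  have [q ->] : exists q, k = q * n%:Z.
    suff : (n%:Z %| k)%Z by move/dvdzP.
    rewrite dvdzE /=; have [r0|r0] := posnP (`|k| %% n)%N; first by rewrite /dvdn r0.
    have := ltn_pmod `|k| n0; rewrite ltnNge => /negP[]; apply: nmin; rewrite /P r0 /=.
    have : a *+ `|k| == 0 by rewrite pmulrn abszEsg mulrC mulrzA ak0 mul0rz.
    by rewrite {1}(divn_eq `|k| n) mulrnDr mulnC mulrnA an mul0rn add0r.
  have -> : pi n%:R^-1 *~ (q * n%:Z) = pi q%:~R.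
    rewrite mulrC mulrzA -pmulrn -!raddfMn -raddfMz; congr (pi _).
    by rewrite -[_ *+ n]mulr_natr mulVf // pnatr_eq0 -lt0n.
  by apply/rat_mod_int_eq0; exists q.
have MzE (x : A) (y : rat_mod_int) k : ((x, y) *~ k : A * rat_mod_int) = (x *~ k, y *~ k).
  by rewrite [LHS]surjective_pairing (raddfMz fst) (raddfMz snd).
have [|f fP] := @hom_extend A _ divisible_rat_mod_int
    [set p | exists k : int, p = (a, t) *~ k].
  split.
  - by exists 0; rewrite mulr0z.
  - by move=> _ _ [k ->] [l ->]; exists (k - l); rewrite mulrzBr.
  - by move=> b [k]; rewrite MzE => -[/esym/tP tk ->].
exists f; suff -> : f a = t by [].
by apply: (fP (a, t)); exists 1; rewrite mulr1z.
Qed.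

(** * Cosets, abelian quotients and wreath products *)

Section Cosets.
Variable G : groupType.
Implicit Types (H K : set G).

Lemma left_coset_eqP H x y :
  subgroup_set H -> left_coset x H = left_coset y H <-> H (x^-1 * y)%g.
Proof.
move=> [H1 HM HV]; split=> [e|Hxy].
  have : left_coset y H y by exists 1%g; rewrite ?mulg1.
  by rewrite -e => -[h Hh <-]; rewrite mulKg.
apply/seteqP; split=> _ [h Hh <-].
  exists (y^-1 * x * h)%g; first by apply: HM => //; rewrite -[(_ * x)%g]invgK invgM invgK; apply: HV.
  by rewrite !mulgA mulgV mul1g.
by exists (x^-1 * y * h)%g; [apply: HM|rewrite !mulgA mulgV mul1g].
Qed.

Lemma abelian_factorP H K :
  subgroup_set H ->
  abelian_factor K H <-> forall x y, K x -> K y -> H [~ x, y]%g.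
Proof.
move=> Hs; split=> ab x y Kx Ky.
  have /left_coset_eqP := ab y x Ky Kx.
  by rewrite invgM -mulgA; apply.
by apply/left_coset_eqP => //; rewrite invgM -mulgA; apply: ab.
Qed.

Lemma torsion_free_factorP H K :
  subgroup_set H ->
  torsion_free_factor K H <->
  forall x m, K x -> (0 < m)%N -> H (x ^+ m)%g -> H x.
Proof.
move=> Hs; have HE x : left_coset x H = H <-> H x.
  have e1 : left_coset 1%g H = H.
    by apply/seteqP; split=> [_ [h Hh <-]|h Hh]; [rewrite mul1g|exists h; rewrite ?mul1g].
  rewrite -{2}e1; split=> [/esym/left_coset_eqP|Hx].
    by rewrite invg1 mul1g; apply.
  by apply/esym/left_coset_eqP; rewrite // invg1 mul1g.
by split=> tf x m Kx m0 /HE Hxm; apply/HE; apply: tf Hxm.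
Qed.

End Cosets.

Section AbelianQuotient.
Variables (G : groupType) (N : set G).
Hypothesis subN : subgroup_set N.
Hypothesis commN : forall x y, N [~ x, y]%g.

Let N1 : N 1%g. Proof. by have [] := subN. Qed.
Let NM x y : N x -> N y -> N (x * y)%g. Proof. by have [_ + _] := subN; apply. Qed.
Let NV x : N x -> N x^-1%g. Proof. by have [_ _] := subN; apply. Qed.

(** Normality comes from [commN], since x ^ y = x [x, y]. *)
Let NJ x y : N x -> N (x ^ y)%g.
Proof.
move=> Nx; rewrite -[(x ^ y)%g](mulVKg x); apply: NM => //; exact: commN.
Qed.

Definition same_coset : rel G := fun x y => `[< N (x^-1 * y)%g >].

Lemma same_coset_refl : reflexive same_coset.
Proof. by move=> x; apply/asboolP; rewrite mulVg. Qed.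

Lemma same_coset_sym : symmetric same_coset.
Proof.
by move=> x y; apply/asboolP/asboolP => /NV; rewrite invgM invgK.
Qed.

Lemma same_coset_trans : transitive same_coset.
Proof.
move=> y x z /asboolP xy /asboolP yz; apply/asboolP.
by rewrite -[z](mulVKg y) mulgA; apply: NM.
Qed.

Canonical same_coset_equiv :=
  EquivRel same_coset same_coset_refl same_coset_sym same_coset_trans.

Definition abquot := {eq_quot same_coset}.
HB.instance Definition _ := Choice.on abquot.
HB.instance Definition _ := Quotient.on abquot.
HB.instance Definition _ := EqQuotient.on abquot.

Lemma abquot_eqP x y : \pi_abquot x = \pi_abquot y <-> N (x^-1 * y)%g.
Proof.
split=> [/eqP|xy]; first by rewrite eqmodE => /asboolP.
by apply/eqP; rewrite eqmodE; apply/asboolP.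
Qed.

Definition abquot_zero : abquot := \pi_abquot 1%g.
Definition abquot_add (p q : abquot) : abquot := \pi_abquot (repr p * repr q)%g.
Definition abquot_opp (p : abquot) : abquot := \pi_abquot (repr p)^-1%g.

Lemma abquot_addE x y :
  abquot_add (\pi_abquot x) (\pi_abquot y) = \pi_abquot (x * y)%g.
Proof.
apply/abquot_eqP; set x' := repr _; set y' := repr _.
have Nx : N (x'^-1 * x)%g by apply/abquot_eqP; rewrite reprK.
have Ny : N (y'^-1 * y)%g by apply/abquot_eqP; rewrite reprK.
have -> : ((x' * y')^-1 * (x * y) = (x'^-1 * x) ^ y' * (y'^-1 * y))%g.
  by rewrite invgM /conjg !mulgA mulgK.
by apply: NM => //; apply: NJ.
Qed.

Lemma abquot_addA : associative abquot_add.
Proof.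
elim/quotW=> x; elim/quotW=> y; elim/quotW=> z.
by rewrite (abquot_addE x y) (abquot_addE y z) !abquot_addE mulgA.
Qed.

Lemma abquot_addC : commutative abquot_add.
Proof.
elim/quotW=> x; elim/quotW=> y; rewrite !abquot_addE; apply/abquot_eqP.
rewrite invgM -mulgA; exact: commN.
Qed.

Lemma abquot_add0 : left_id abquot_zero abquot_add.
Proof. by elim/quotW=> x; rewrite abquot_addE mul1g. Qed.

Lemma abquot_addN : left_inverse abquot_zero abquot_opp abquot_add.
Proof.
move=> p; rewrite -{2}[p]reprK abquot_addE mulVg //.
Qed.

HB.instance Definition _ := GRing.isZmodule.Build abquot
  abquot_addA abquot_addC abquot_add0 abquot_addN.

Lemma abelian_quotient : exists (B : zmodType) (f : G -> B),
  [/\ forall x y, f (x * y)%g = f x + f y,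
      forall x, f x = 0 <-> N x
    & forall b, exists x, f x = b].
Proof.
exists abquot, \pi_abquot; split.
- by move=> x y; rewrite -abquot_addE.
- move=> x; split=> [/esym/abquot_eqP|Nx]; first by rewrite invg1 mul1g.
  by apply/esym/abquot_eqP; rewrite invg1 mul1g.
- by move=> b; exists (repr b); rewrite reprK.
Qed.

End AbelianQuotient.

(** * The unrestricted wreath product *)

Section Wreath.
Variables (H : groupType) (V : zmodType).

Definition wreath := ((V -> H) * V)%type.
HB.instance Definition _ := Choice.on wreath.
Implicit Types (p q r : wreath).

Definition wreath_one : wreath := (fun=> 1%g, 0).
(** The semidirect product in which a in V acts on functions V -> H by translation, sending f to v
    |-> f (v - a). *)
Definition wreath_mul p q : wreath :=
  (fun v => (p.1 v * q.1 (v - p.2))%g, p.2 + q.2).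
Definition wreath_inv p : wreath := (fun v => (p.1 (v + p.2)%R)^-1%g, - p.2).

Lemma wreath_mulA : associative wreath_mul.
Proof.
move=> p q r; congr pair; rewrite /= ?addrA //.
by apply/funext => v; rewrite mulgA opprD addrA.
Qed.

Lemma wreath_mul1 : left_id wreath_one wreath_mul.
Proof.
case=> f a; congr pair; rewrite /= ?add0r //.
by apply/funext => v; rewrite subr0 mul1g.
Qed.

Lemma wreath_mulr1 : right_id wreath_one wreath_mul.
Proof.
by case=> f a; congr pair; rewrite /= ?addr0 //; apply/funext => v; rewrite mulg1.
Qed.

Lemma wreath_mulV : left_inverse wreath_one wreath_inv wreath_mul.
Proof.
case=> f a; congr pair; rewrite /= ?addNr //.
by apply/funext => v; rewrite opprK mulVg.
Qed.

Lemma wreath_mulrV : right_inverse wreath_one wreath_inv wreath_mul.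
Proof.
case=> f a; congr pair; rewrite /= ?addrN //.
by apply/funext => v; rewrite subrK mulgV.
Qed.

HB.instance Definition _ := isGroup.Build wreath
  wreath_mulA wreath_mul1 wreath_mulr1 wreath_mulV wreath_mulrV.

Lemma wreathM1 p q v : (p * q)%g.1 v = (p.1 v * q.1 (v - p.2))%g.
Proof. by []. Qed.

Lemma wreathM2 p q : (p * q)%g.2 = p.2 + q.2.
Proof. by []. Qed.

Lemma wreathV1 p v : p^-1%g.1 v = (p.1 (v + p.2)%R)^-1%g.
Proof. by []. Qed.

Lemma wreathV2 p : p^-1%g.2 = - p.2.
Proof. by []. Qed.

Lemma wreathX2 p n : (p ^+ n)%g.2 = p.2 *+ n.
Proof. by elim: n => [|n IH] //; rewrite expgS wreathM2 IH mulrS. Qed.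

Lemma wreathX1 p n v : p.2 = 0 -> (p ^+ n)%g.1 v = (p.1 v ^+ n)%g.
Proof.
by move=> p0; elim: n => [|n IH] //; rewrite !expgS wreathM1 p0 subr0 IH.
Qed.

Definition wreath_base (T : set H) : set wreath :=
  [set p | p.2 = 0 /\ forall v, T (p.1 v)].

Lemma subgroup_wreath_base T : subgroup_set T -> subgroup_set (wreath_base T).
Proof.
move=> [T1 TM TV]; split; first by [].
- move=> p q [p0 pT] [q0 qT]; split=> [|v]; first by rewrite wreathM2 p0 q0 addr0.
  by rewrite wreathM1; apply: TM.
- move=> p [p0 pT]; split=> [|v]; first by rewrite wreathV2 p0 oppr0.
  by rewrite wreathV1; apply: TV.
Qed.

Lemma wreath_baseJ p q v :
  p.2 = 0 -> q.2 = 0 -> (p ^ q)%g.1 v = (p.1 v ^ q.1 v)%g.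
Proof.
move=> p0 q0; rewrite /conjg !wreathM1 wreathV1 wreathV2 p0 q0.
by rewrite oppr0 !subr0 !addr0.
Qed.

End Wreath.

(** * Systems over a wreath product *)

Lemma additive_of (A B : zmodType) (f : A -> B) :
  zmod_morphism f -> exists g : {additive A -> B}, g =1 f.
Proof.
move=> fB; pose fA := GRing.isZmodMorphism.Build _ _ f fB.
by pose g : {additive A -> B} := HB.pack f fA; exists g.
Qed.

Lemma rat_seq_bound (s : seq rat) : exists N : nat, forall b, b \in s -> b < N%:R.
Proof.
elim: s => [|b s [N NP]]; first by exists 0%N.
exists (maxn N (Num.bound b)) => c; rewrite inE => /orP[/eqP ->|/NP cN].
  apply: (le_lt_trans (ler_norm b)).
  have := archi_boundP (normr_ge0 b); rewrite /Num.bound normr_id => /lt_le_trans.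
  by apply; rewrite ler_nat leq_maxr.
by apply: (lt_le_trans cN); rewrite ler_nat leq_maxl.
Qed.

(** Induction on s: if f kills the new element v and g does not, replace f by N f + g. Taking N
    larger than every -g x / f x keeps the values on nonzero x in s nonzero. *)
Lemma torsion_free_separated_seq (V : zmodType) (s : seq V) :
  torsion_free V ->
  exists f : {additive V -> rat}, forall v, v \in s -> v != 0 -> f v != 0.
Proof.
move=> tfV; elim: s => [|v s [f fP]].
  have [f _] : exists f : {additive V -> rat}, f =1 fun=> 0.
    by apply: additive_of => x y; rewrite subr0.
  by exists f.
have [v0|v0] := eqVneq v 0.
  by exists f => x; rewrite inE => /orP[/eqP ->|/fP//]; rewrite v0 eqxx.
have [fv|fv] := eqVneq (f v) 0; last first.
  by exists f => x; rewrite inE => /orP[/eqP ->|/fP].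
have [g gv] := torsion_free_separated tfV v0.
have [N NP] := rat_seq_bound [seq - g x / f x | x <- s].
have [h hE] : exists h : {additive V -> rat}, h =1 fun x => f x * N%:R + g x.
  by apply: additive_of => x y; rewrite !raddfB mulrBl opprD addrACA.
exists h => x; rewrite hE inE => /orP[/eqP -> _|xs x0]; first by rewrite fv mul0r add0r.
have fx := fP x xs x0; have := NP _ (map_f _ xs).
apply: contraTneq => /eqP; rewrite addrC addr_eq0 => /eqP ->.
by rewrite opprK mulrAC mulfV // mul1r ltxx.
Qed.

Lemma poly_shift (R : comNzRingType) (s : R) (p : {poly R}) :
  exists2 r : {poly R}, (size r <= (size p).-1)%N
    & forall x, p.[x - s] = p.[x] + r.[x].
Proof.
elim/poly_ind: p => [|p c [r rp rP]].
  by exists 0; rewrite ?size_poly0 // => x; rewrite !horner0 addr0.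
have [p0|p0] := eqVneq p 0.
  exists 0; rewrite ?size_poly0 // => x; rewrite p0 mul0r add0r !hornerC.
  by rewrite addr0.
(* Substitute p(x - s) = p(x) + r(x) in p(x - s)(x - s) + c and subtract p(x) x + c. *)
exists (r * ('X - s%:P) - s *: p).
  rewrite size_MXaddC (negPf p0) /=; apply: (leq_trans (size_polyD _ _)).
  rewrite geq_max size_polyN (leq_trans (size_scale_leq _ _)) // andbT.
  have [->|r0] := eqVneq r 0; first by rewrite mul0r size_poly0.
  apply: (leq_trans (size_polyMleq _ _)).
  rewrite size_XsubC addn2 /=; apply: (leq_ltn_trans rp).
  by rewrite prednK // lt0n size_poly_eq0.
by move=> x; rewrite !(hornerD, hornerMXaddC, hornerN, hornerZ, hornerM, hornerX, hornerC) rP; ring.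
Qed.

Lemma clear_denominators (T : eqType) (s : seq T) (m : T -> rat) :
  exists2 N : int, N != 0 &
    forall t, t \in s -> exists k : int, m t * N%:~R = k%:~R.
Proof.
elim: s => [|a s [N N0 NP]]; first by exists 1.
exists (N * denq (m a)); first by rewrite mulf_neq0 // denq_neq0.
move=> t; rewrite inE => /orP[/eqP ->|/NP [k kE]].
  exists (numq (m a) * N); rewrite !rmorphM /= [in RHS]numqE mulrA.
  by rewrite mulrAC.
by exists (k * denq (m a)); rewrite !rmorphM /= mulrA kE.
Qed.

(** Clearing denominators turns a rational relation between the rows e_j into an integral one. *)
Lemma rat_independent (I J : choiceType) (e : J -> {freeg I / int})
    (s : seq J) (m : J -> rat) :
    Z_independent e -> uniq s ->
    (forall i, \sum_(j <- s) m j * (coeff i (e j))%:~R = 0) ->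
  forall j, j \in s -> m j = 0.
Proof.
move=> e_ind us m0 j js; have [N N0 NP] := clear_denominators s m.
have kP : forall j, exists k : int, j \in s -> m j * N%:~R = k%:~R.
  move=> i; have [/NP[k kE]|_] := boolP (i \in s); first by exists k.
  by exists 0.
have {kP} [k kP] := choice kP.
have /(e_ind s k us)/(_ j js) kj : \sum_(j <- s) e j *~ k j = 0.
  apply/eqP/freeg_eqP => i; rewrite raddf0 raddf_sum /=.
  apply: (@intr_inj rat); rewrite rmorph_sum /=.
  transitivity ((\sum_(l <- s) m l * (coeff i (e l))%:~R) * N%:~R).
    rewrite big_distrl /=; apply: eq_big_seq => l ls.
    by rewrite raddfMz mulrzz rmorphM /= -kP // mulrCA mulrA.
  by rewrite m0 mul0r.
have := kP j js; rewrite kj => /eqP; rewrite mulf_eq0 intr_eq0 (negPf N0) orbF.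
by move/eqP.
Qed.

Lemma sum_fibers (S J : eqType) (A : nmodType) (f : S -> J) (s : seq S)
    (F : S -> A) :
  \sum_(j <- undup [seq f x | x <- s]) \sum_(x <- s | f x == j) F x =
  \sum_(x <- s) F x.
Proof.
rewrite (exchange_big_dep xpredT) //=; apply: eq_big_seq => x xs.
have fx : f x \in undup [seq f x | x <- s] by rewrite mem_undup map_f.
rewrite -big_filter (perm_big [:: f x]) ?big_seq1 //.
apply: uniq_perm; rewrite ?filter_uniq ?undup_uniq // => j.
by rewrite mem_filter inE eq_sym; case: eqVneq => // ->.
Qed.

(** * Equations over a wreath product read coordinate by coordinate *)

Section Spread.
Variables (H : groupType) (V : zmodType) (I : choiceType) (v : I -> V).
Local Notation K := (wreath H V).

Definition letter_shift (l : letter K I) : V :=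
  match l with inl p => p.2 | inr (i, e) => if e then - v i else v i end.

(* The value at u of the H-component of a word in the wreath product, when x_i
   is sent to (y_i, v i) with y_i : V -> H unknown: the unknown (i, u) stands
   for y_i u. *)
Definition spread_letter (u : V) (l : letter K I) : letter H (I * V)%type :=
  match l with
  | inl p => inl (p.1 u)
  | inr (i, e) => inr ((i, if e then u + v i else u), e)
  end.

(** The product (f, a)(g, b) has value f u * g (u - a) at u, hence the shift of u after each letter.
    An inverse letter involves the unknown at u + v i because (y, a)^-1 has value (y (u + a))^-1 at
    u. *)
Fixpoint spread (u : V) (w : word K I) : word H (I * V)%type :=
  if w is l :: w' then spread_letter u l :: spread (u - letter_shift l) w'
  else [::].

Lemma word_val_shift (x : I -> K) w :
  (forall i, (x i).2 = v i) ->
  (word_val (idfun : {hom K -> K}) x w).2 = \sum_(l <- w) letter_shift l.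
Proof.
move=> xv; rewrite /word_val; elim: w => [|l w IH]; first by rewrite !big_nil.
rewrite !big_cons wreathM2 IH; congr (_ + _).
by case: l => [p|[i [|]]] //=; rewrite ?wreathV2 xv.
Qed.

Lemma word_val_spread (y : I * V -> H) w u :
  (word_val (idfun : {hom K -> K}) (fun i => (fun t => y (i, t), v i) : K) w).1 u =
  word_val (idfun : {hom H -> H}) y (spread u w).
Proof.
rewrite /word_val; elim: w u => [|l w IH] u; first by rewrite !big_nil.
rewrite /= !big_cons wreathM1; congr (_ * _)%g; first by case: l => [p|[i [|]]].
rewrite -IH; congr ((_).1 (_ - _)).
by case: l => [p|[i [|]]].
Qed.

Definition letter_const (l : letter K I) : V := if l is inl p then p.2 else 0.

(** The V-component of a word is a constant plus its exponent row evaluated at v, so the image of a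
    system in V is linear with the same rows. *)
Lemma sum_letter_shift w :
  \sum_(l <- w) letter_shift l =
  \sum_(l <- w) letter_const l + zlift v (word_expsum w).
Proof.
rewrite /word_expsum raddf_sum -big_split; apply: eq_bigr => l _ /=.
by case: l => [p|[i [|]]] /=; rewrite ?raddf0 ?addr0 ?add0r ?raddfN /= ?zliftU.
Qed.

Definition poly_weight (f : V -> rat) (p : {poly rat}) (i : I) (iu : I * V) : rat :=
  p.[f iu.2] * (iu.1 == i)%:R.

(** Each occurrence of x_i is read at u minus some shift independent of u, so it contributes p(f u)
    with its sign, up to a polynomial in f u of smaller degree. *)
Lemma zlift_spread (f : {additive V -> rat}) (p : {poly rat}) i w :
  exists2 r : {poly rat}, (size r <= (size p).-1)%N
    & forall u, zlift (poly_weight f p i) (word_expsum (spread u w)) =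
      p.[f u] * (coeff i (word_expsum w))%:~R + r.[f u].
Proof.
rewrite /word_expsum; elim: w => [|l w [r rp rP]].
  exists 0; rewrite ?size_poly0 // => u.
  by rewrite /= !big_nil !raddf0 mulr0 horner0 addr0.
(* The tail of the word is evaluated at u minus the shift of [l]: [r1] and [r2] correct p and the
   tail's remainder for this. [r3] corrects the first letter, which is read off u only when it is an
   inverse. *)
have [r1 r1p r1P] := poly_shift (f (letter_shift l)) p.
have [r2 r2p r2P] := poly_shift (f (letter_shift l)) r.
have [r3 r3p r3P] : exists2 r3 : {poly rat}, (size r3 <= (size p).-1)%N
    & forall u, zlift (poly_weight f p i) (letter_expsum (spread_letter u l)) =
        p.[f u] * (coeff i (letter_expsum l))%:~R + r3.[f u].
  case: l {r1 r2 r1p r2p r1P r2P} => [g|[k e]] /=.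
    exists 0; rewrite ?size_poly0 // => u.
    by rewrite !raddf0 mulr0 horner0 addr0.
  have kE : (coeff i << k >> : int)%:~R = (k == i)%:R :> rat.
    by rewrite coeffU mul1r; case: (k == i).
  case: e => /=; last first.
    exists 0; rewrite ?size_poly0 // => u.
    by rewrite zliftU kE horner0 addr0.
  have [r3 r3p r3P] := poly_shift (- f (v k)) p.
  exists (- (k == i)%:R *: r3); first exact: leq_trans (size_scale_leq _ _) r3p.
  move=> u; rewrite !raddfN /= zliftU kE /poly_weight /= raddfD /=.
  have := r3P (f u); rewrite opprK => ->.
  by rewrite hornerE mulrDl opprD !mulNr mulrN [_ * r3.[_]]mulrC.
pose C := (coeff i (\sum_(l <- w) letter_expsum l))%:~R : rat.
exists (r3 + C *: r1 + r + r2).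
  have Cr1p := leq_trans (size_scale_leq C r1) r1p.
  have {}r2p := leq_trans r2p (leq_trans (leq_pred _) rp).
  by do 3 (apply: (leq_trans (size_polyD _ _)); rewrite geq_max; apply/andP; split=> //).
move=> u; rewrite /= !big_cons raddfD /= rP r3P raddfB /= r1P r2P.
rewrite raddfD /= rmorphD /= !(hornerD, hornerZ) -/C.
by ring.
Qed.
End Spread.

Lemma spread_independent (H : groupType) (V : zmodType) (I J : choiceType)
    (v : I -> V) (w : J -> word (wreath H V) I) :
  torsion_free V -> Z_independent (fun j => word_expsum (w j)) ->
  Z_independent (fun ju : J * V => word_expsum (spread v ju.2 (w ju.1))).
Proof.
move=> tfV w_ind s c us rel [j0 u0] s0.
pose us' := [seq ju.2 | ju <- s].
(* Separating all differences makes f injective on the V-indices occurring in s. *)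
have [f fP] := torsion_free_separated_seq [seq a - b | a <- us', b <- us'] tfV.
pose m (p : {poly rat}) j : rat := \sum_(ju <- s | ju.1 == j) (c ju)%:~R * p.[f ju.2].
have m0 n (p : {poly rat}) : (size p <= n)%N -> forall j, m p j = 0.
  elim: n p => [|n IH] p pn j.
    move: pn; rewrite leqn0 size_poly_eq0 => /eqP ->.
    by rewrite /m big1 // => ju _; rewrite horner0 mulr0.
  have [js|js] := boolP (j \in undup [seq ju.1 | ju <- s]); last first.
    rewrite /m big_seq_cond big_pred0 // => ju; apply/negP => /andP[ju_s /eqP e].
    by case/negP: js; rewrite mem_undup -e map_f.
  apply: (rat_independent w_ind (undup_uniq _) _ js) => i.
  (* The weighted relation is the sum over j of [m p j] times the exponent of x_i in w_j, plus
     moments of polynomials of smaller degree, which vanish by induction. *)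
  have := congr1 (zlift (poly_weight f p i)) rel; rewrite raddf0 raddf_sum /=.
  move=> rel0; rewrite -[RHS]rel0 -[RHS](sum_fibers fst); apply: eq_bigr => j' _.
  have [r rp rP] := zlift_spread v f p i (w j').
  have rn : (size r <= n)%N by apply: leq_trans rp _; rewrite -ltnS; case: (size p) pn.
  transitivity (m p j' * (coeff i (word_expsum (w j')))%:~R + m r j').
    by rewrite (IH _ rn) addr0.
  rewrite /m mulr_suml -big_split /=; apply: eq_bigr => ju /eqP juj.
  rewrite raddfMz /= -mulrzl juj rP; ring.
(* Lagrange interpolation: p vanishes at f u for every other (j0, u) in s but not at f u0, so only
   the term of c (j0, u0) survives in [m p j0]. *)
pose p := \prod_(ju <- s | (ju.1 == j0) && (ju.2 != u0)) ('X - (f ju.2)%:P).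
have := m0 _ p (leqnn _) j0; rewrite /m big_mkcond (bigD1_seq (j0, u0)) //= eqxx.
rewrite big1_seq ?addr0.
  move/eqP; rewrite mulf_eq0 intr_eq0 => /orP[/eqP//|].
  rewrite horner_prod prodf_seq_eq0 => /hasP[[j u] /= ju_s].
  rewrite hornerXsubC subr_eq0 => /andP[/andP[_ uu0] /eqP fuu].
  have := fP (u0 - u); rewrite raddfB /= fuu subrr eqxx => h.
  suff : false by []. apply: h.
    apply: allpairs_f; [exact: (map_f snd s0)|exact: (map_f snd ju_s)].
  by rewrite subr_eq0 eq_sym.
move=> [j u] /= /andP[ju0 ju_s]; case: eqP => // jj0.
suff -> : p.[f u] = 0 by rewrite mulr0.
apply/eqP; rewrite horner_prod prodf_seq_eq0; apply/hasP; exists (j, u) => //=.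
rewrite hornerXsubC subrr jj0 !eqxx /= andbT.
by apply: contraNneq ju0 => ->; rewrite jj0.
Qed.

(** * Solving systems over a wreath product *)

Definition all_solvable (G : groupType) : Prop :=
  forall (I J : choiceType) (w : J -> freeprod G I),
    nonsingular w -> has_solution (idfun : {hom G -> G}) w.

Lemma zlift_unique (I : choiceType) (A : zmodType)
    (f : {additive {freeg I / int} -> A}) : f =1 zlift (fun i => f << i >>).
Proof.
move=> D; rewrite zliftE -{1}[D]freeg_sumE raddf_sum; apply: eq_bigr => i _.
by rewrite -raddfMz /= freegU_mulz intz.
Qed.

(** The V-components v are found first; the H-components then solve the spread system. That system
    depends on v, hence the quantification over all v in the hypothesis. *)
Lemma wreath_all_solvable (H : groupType) (V : zmodType) :
    divisible V ->
    (forall (I J : choiceType) (v : I -> V) (w : J -> word (wreath H V) I),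
      Z_independent (fun j => word_expsum (w j)) ->
      has_solution (idfun : {hom H -> H})
        (fun ju : J * V => \pi_(freeprod H (I * V)%type) (spread v ju.2 (w ju.1)))) ->
  all_solvable (wreath H V).
Proof.
move=> divV solH I J w w_ind.
(* The value prescribed on each row cancels the constant part in [sum_letter_shift]; the values of f
   on the basis are the V-components of the solution. *)
have [f fP] := independent_extend
  (fun j => - \sum_(l <- repr (w j)) letter_const l) divV w_ind.
pose v i := f << i >>.
have [y yP] := solH I J v (fun j => repr (w j)) w_ind.
exists (fun i => (fun u => y (i, u), v i)) => j; rewrite /fp_subst.
apply: injective_projections.
  apply/funext => u; rewrite word_val_spread -fp_substE.
  exact: (yP (j, u)).
rewrite (@word_val_shift _ _ _ v) // sum_letter_shift -zlift_unique.
by rewrite [f _]fP addrN.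
Qed.

Lemma wreath_all_solvable_torsion_free (H : groupType) (V : zmodType) :
    divisible V -> torsion_free V -> all_solvable H ->
  all_solvable (wreath H V).
Proof.
move=> divV tfV solH; apply: wreath_all_solvable divV _ => I J v w w_ind.
apply: solH => s c us s0.
apply: (spread_independent tfV w_ind us) => //; rewrite -[RHS]s0.
by apply: eq_bigr => ju _; rewrite fp_expsumE.
Qed.

Lemma wreath_all_solvable_trivial (H : groupType) (V : zmodType) :
    divisible V -> (forall h : H, h = 1%g) -> all_solvable (wreath H V).
Proof.
move=> divV H1; apply: wreath_all_solvable divV _ => I J v w w_ind.
by exists (fun=> 1%g) => ju; apply: H1.
Qed.

(** * The embedding *)

Section Subgroup.
Variables (G : groupType) (N : set G).
Hypothesis subN : subgroup_set N.

Definition subgroup_pred : {pred G} := fun x => `[< N x >].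
(** The type carries the proof that [N] is a subgroup, so that the group structure can be attached
    to it. *)
Definition subgroup_type (_ : subgroup_set N) := {x : G | subgroup_pred x}.
Local Notation subgroup := (subgroup_type subN).
HB.instance Definition _ := SubChoice.on subgroup.

Lemma subgroup_pred_closed : group_closed subgroup_pred.
Proof.
have [N1 NM NV] := subN; split; first exact/asboolP.
by move=> x y /asboolP Nx /asboolP Ny; apply/asboolP/NM => //; apply: NV.
Qed.

HB.instance Definition _ :=
  SubChoice_isSubGroup.Build G subgroup_pred subgroup subgroup_pred_closed.

Lemma subgroup_val1 : \val (1%g : subgroup) = 1%g.
Proof. exact: gmulf1. Qed.

Lemma subgroup_valM : {morph (\val : subgroup -> G) : x y / (x * y)%g}.
Proof. exact: gmulfM. Qed.

Lemma subgroup_valV : {morph (\val : subgroup -> G) : x / (x^-1)%g}.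
Proof. exact: gmulfV. Qed.

Lemma subgroup_valP (x : subgroup) : N (val x).
Proof. exact/asboolP/(valP x). Qed.

(** Total on G, with default value 1 outside [N]; only its values on [N] matter in
    [kaloujnine_krasner]. *)
Definition to_subgroup (x : G) : subgroup := insubd (1%g : subgroup) x.

Lemma to_subgroupK x : N x -> val (to_subgroup x) = x.
Proof. by move=> Nx; rewrite /to_subgroup insubdK //; apply/asboolP. Qed.

Lemma to_subgroupM x y :
  N x -> N y -> to_subgroup (x * y)%g = (to_subgroup x * to_subgroup y)%g.
Proof.
move=> Nx Ny; apply: val_inj; have [_ NM _] := subN.
by rewrite to_subgroupK ?gmulfM ?[X in _ = (X * _)%g]to_subgroupK
  ?[X in _ = (_ * X)%g]to_subgroupK //; apply: NM.
Qed.

Lemma subgroup_series n (S : nat -> set G) :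
  abelian_tf_series n.+1 S -> N = S 2 ->
  abelian_tf_series n (fun i => [set x : subgroup | S i.+1 (val x)]).
Proof.
move=> [[S1 Sn] Ssub Snorm Sab Stf] N2.
have sub' i : (1 <= i <= n.+1)%N ->
    subgroup_set [set x : subgroup | S i.+1 (val x)].
  move=> /andP[i1 i2]; have [|H1 HM HV] := Ssub i.+1; first by apply/andP; split.
  split; first by rewrite /mkset subgroup_val1.
    by move=> x y; rewrite /mkset subgroup_valM; apply: HM.
  by move=> x; rewrite /mkset subgroup_valV; apply: HV.
have bnd i : (1 <= i <= n)%N -> (1 <= i.+1 <= n.+1)%N by case/andP.
have bnd2 i : (1 <= i <= n)%N -> (1 <= i.+1 <= n.+1)%N /\ (1 <= i.+2 <= n.+2)%N.
  by case/andP => ? ?; split=> //; rewrite !ltnS.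
split=> //.
- split; apply/seteqP; split=> x //; rewrite /mkset -?N2 ?Sn.
  + by move=> _; apply: subgroup_valP.
  + by move=> x1; apply: val_inj; rewrite x1 subgroup_val1.
  + by move=> ->; rewrite subgroup_val1.
- move=> i /bnd /Snorm [SS SJ]; split=> [x|x y]; first exact: SS.
  by rewrite /mkset /conjg !subgroup_valM subgroup_valV; apply: SJ.
- move=> i hi; have [hi1 hi2] := bnd2 _ hi.
  apply/abelian_factorP => [|x y Sx Sy]; first by apply: sub'; case/andP: hi.
  have /abelian_factorP := Sab _ hi1.
  rewrite /mkset /commg /conjg !subgroup_valM !subgroup_valV; apply => //; exact: Ssub.
- move=> i hi; apply/torsion_free_factorP => [|x m Sx m0].
    by apply: sub'; case/andP: hi => ? ?; apply/andP; split=> //; apply: ltnW.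
  have si2 : subgroup_set (S i.+2).
    by apply: Ssub; case/andP: hi => ? ?; apply/andP; split=> //; apply: ltnW.
  have /(torsion_free_factorP _ si2) tf : torsion_free_factor (S i.+1) (S i.+2).
    by apply: Stf; case/andP: hi.
  rewrite /mkset; have -> : val (x ^+ m)%g = (val x ^+ m)%g.
    by elim: m {m0} => [|m IH]; rewrite ?subgroup_val1 // !expgS subgroup_valM IH.
  exact: tf.
Qed.

End Subgroup.

(* The Kaloujnine-Krasner embedding: s v is an element of G carrying the chosen
   representative t v of the coset v + f(G) to v. *)
Lemma kaloujnine_krasner (G H : groupType) (V : zmodType) (N : set G)
    (f : G -> V) (psi : G -> H) :
    (forall x y, f (x * y)%g = f x + f y) -> (forall x, f x = 0 <-> N x) ->
    (forall x y, N x -> N y -> psi (x * y)%g = (psi x * psi y)%g) ->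
    (forall x, N x -> psi x = 1%g -> x = 1%g) ->
  exists iota : {hom G -> wreath H V}, injective iota.
Proof.
move=> fM fN psiM psi_inj.
have f1 : f 1%g = 0 by apply: (addrI (f 1%g)); rewrite -fM mulg1 addr0.
have fV x : f x^-1%g = - f x by apply/eqP; rewrite -addr_eq0 -fM mulVg f1.
pose P v : pred V := fun u => `[< exists g, f g = v - u >].
have Pv v : P v v by apply/asboolP; exists 1%g; rewrite subrr.
(* [choose] gives the same element for equivalent predicates and any admissible starting point, so t
   is constant on cosets of f(G); this is [tE]. *)
pose t v := choose (P v) v.
have tP v : exists g, f g = v - t v by apply/asboolP/(chooseP (Pv v)).
have [s sP] := choice tP.
have tE v g : t (v - f g) = t v.
  have PE : P (v - f g) =1 P v.
    move=> u; apply/asboolP/asboolP => -[h hE].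
      by exists (h * g)%g; rewrite fM hE addrAC subrK.
    by exists (h * g^-1)%g; rewrite fM hE fV addrAC.
  rewrite /t (eq_choose PE); apply: choose_id => //.
  by rewrite -PE.
(* Since f (s v) = v - t v and t is constant on cosets, F g v is in the kernel [N] of f. The factors
   s telescope in F (x y) v = F x v * F y (v - f x), which matches the wreath multiplication. *)
pose F g v := ((s v)^-1 * g * s (v - f g))%g.
have NF g v : N (F g v).
  by apply/fN; apply/eqP; rewrite !fM fV !sP tE addr_eq0 !opprB addrAC addrA.
pose io g : wreath H V := (fun v => psi (F g v), f g).
have ioM : {morph io : x y / (x * y)%g}.
  move=> x y; apply: injective_projections; last exact: fM.
  apply/funext => v; rewrite wreathM1 -[RHS]psiM //; congr psi.
  by rewrite /F fM opprD addrA !mulgA mulgK.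
have io1 : io 1%g = 1%g.
  by apply: (mulgI (io 1%g)); rewrite -ioM !mulg1.
pose ioH := isUMagmaMorphism.Build G (wreath H V) io (conj io1 ioM).
pose iota : {hom G -> wreath H V} := HB.pack io ioH.
exists iota => x y xy; apply/eqP; rewrite -divg_eq1; apply/eqP.
have : io (x * y^-1)%g = 1%g.
  rewrite ioM; have -> : io x = io y by [].
  by rewrite -ioM mulgV io1.
move: (x * y^-1)%g => z z1.
have fz : f z = 0 by have := congr1 snd z1.
(* As f z = 0, the coordinate at 0 is a conjugate of z, so it is trivial only if z is. *)
have : F z 0 = 1%g.
  by apply: psi_inj => //; have := congr1 (fun p => p.1 0) z1.
rewrite /F fz subr0 => /(congr1 (fun x => s 0 * x * (s 0)^-1)%g).
by rewrite !mulgA mulgV mul1g mulgK mulg1 mulgV.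
Qed.

(** The second term is the whole base group because T 1 = H, so the new top factor is V. The later
    factors are powers of those of T, and properties are checked coordinatewise. *)
Lemma wreath_series (H : groupType) (V : zmodType) n (T : nat -> set H) :
    (0 < n)%N -> torsion_free V -> abelian_tf_series n T ->
  abelian_tf_series n.+1
    (fun i => if (i <= 1)%N then setT else wreath_base (V := V) (T i.-1)).
Proof.
move=> n0 tfV [[T1 Tn] Tsub Tnorm Tab Ttf].
have Ssub i : (1 <= i <= n.+2)%N ->
    subgroup_set (if (i <= 1)%N then setT else wreath_base (V := V) (T i.-1)).
  case: i => [|[|i]] //= hi; apply: subgroup_wreath_base; exact: Tsub.
have comm2 (p q : wreath H V) : [~ p, q]%g.2 = 0.
  rewrite /commg /conjg !(wreathM2, wreathV2).
  by rewrite [_ + (p.2 + _)]addrC addrK addNr.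
have comm1 (p q : wreath H V) u : p.2 = 0 -> q.2 = 0 ->
    [~ p, q]%g.1 u = [~ p.1 u, q.1 u]%g.
  move=> p0 q0; rewrite /commg wreathM1 wreathV1 wreathV2 p0 oppr0 subr0 addr0.
  by rewrite wreath_baseJ.
have conj2 (p q : wreath H V) : p.2 = 0 -> (p ^ q)%g.2 = 0.
  by move=> p0; rewrite /conjg !(wreathM2, wreathV2) p0 add0r addNr.
split=> //.
- split=> //; case: n n0 Tn {Tsub Tnorm Tab Ttf Ssub} => // n _ Tn /=.
  rewrite Tn; apply/seteqP; split=> [p [p0 p1]|p ->] //=.
  by apply: injective_projections => //; apply/funext => u; apply: p1.
- case=> [|[|i]] //= hi; split=> //.
  + by move=> p q [p0 _] _; split=> [|u]; [apply: conj2|rewrite T1].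
  + have [TT _] := Tnorm i.+1 hi.
    by move=> p [p0 pT]; split=> // u; apply: TT.
  + have [_ TJ] := Tnorm i.+1 hi.
    move=> p q [p0 pT] [q0 qT]; split=> [|u]; first exact: conj2.
    by rewrite wreath_baseJ //; apply: TJ.
- case=> [|[|i]] //= hi; apply/abelian_factorP.
  + exact: (Ssub 2).
  + by move=> p q _ _; split=> [|u]; rewrite ?comm2 // T1.
  + exact: (Ssub i.+3 hi).
  + have /abelian_factorP tab := Tab i.+1 hi.
    move=> p q [p0 pT] [q0 qT]; split=> [|u]; rewrite ?comm2 // comm1 //.
    exact: (tab (Tsub i.+2 hi)).
- case=> [|[|i]] //= hi; apply/torsion_free_factorP.
  + exact: (Ssub 2).
  + move=> p m _ m0 []; rewrite wreathX2 => pm _; split=> [|u]; last by rewrite T1.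
    exact: tfV m0 pm.
  + exact: (Ssub i.+3 (ltnW hi)).
  + have /torsion_free_factorP ttf := Ttf i.+1 hi.
    move=> p m [p0 pT] m0 [_ pm]; split=> // u.
    by apply: (ttf (Tsub i.+2 (ltnW hi)) _ _ (pT u) m0); rewrite -wreathX1.
Qed.

Lemma trivial_subgroup (G : groupType) : subgroup_set [set 1%g : G].
Proof. by split=> // [x y -> ->|x ->]; rewrite ?mulg1 ?invg1. Qed.

(** With [H] trivial the wreath product is a copy of the divisible group V; keeping the wreath form
    lets the general embedding and solvability lemmas apply. *)
Lemma embedding_base (G : groupType) (S : nat -> set G) :
    abelian_tf_series 1 S ->
  exists (Gt : groupType) (iota : {hom G -> Gt}) (St : nat -> set Gt),
    [/\ injective iota, abelian_tf_series 1 St & all_solvable Gt].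
Proof.
move=> [[S1 S2] Ssub _ Sab _]; have sub1 := trivial_subgroup G.
have ab (x y : G) : [set 1%g] [~ x, y]%g.
  have /(abelian_factorP _ (Ssub 2 isT)) := Sab 1 isT.
  by rewrite -S2 S1; apply.
have [B [f [fM fN _]]] := abelian_quotient sub1 ab.
have [ev ev_inj] := eval_embedding (@separated_rat_mod_int B).
pose V : zmodType := (B -> rat_mod_int) -> rat_mod_int.
pose H : groupType := subgroup_type sub1.
have H1 (h : H) : h = 1%g by apply: val_inj; rewrite (subgroup_valP h) gmulf1.
have [iota iota_inj] : exists iota : {hom G -> wreath H V}, injective iota.
  apply: (@kaloujnine_krasner _ H V [set 1%g] (ev \o f) (fun=> 1%g)).
  - by move=> x y /=; rewrite fM raddfD.
  - move=> x /=; apply: (iff_trans _ (fN x)); split=> [|->]; last exact: raddf0.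
    by rewrite -(raddf0 ev); apply: ev_inj.
  - by move=> x y _ _; rewrite mulg1.
  - by move=> x.
exists (wreath H V), iota, (fun i => if i == 1%N then setT else [set 1%g]).
split=> //; last first.
  by apply: wreath_all_solvable_trivial => //; apply/divisible_fun/divisible_rat_mod_int.
have C (p q : wreath H V) : (p * q = q * p)%g.
  apply: injective_projections; last exact: addrC.
  by apply/funext => u; rewrite [LHS]H1 [RHS]H1.
split=> //.
- case=> [|[|i]] //= _; exact: trivial_subgroup.
- case=> [|[|i]] //= _; split=> // h k -> _.
  by rewrite /conjg mul1g mulVg.
- by case=> [|[|i]] //= _ x y _ _; rewrite C.
- by case=> [|[|i]].
Qed.

Lemma embedding (n : nat) (G : groupType) (S : nat -> set G) :
    abelian_tf_series n.+1 S ->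
  exists (Gt : groupType) (iota : {hom G -> Gt}) (St : nat -> set Gt),
    [/\ injective iota, abelian_tf_series n.+1 St & all_solvable Gt].
Proof.
elim: n G S => [|n IH] G S hS; first exact: embedding_base hS.
have [[S1 _] Ssub _ Sab Stf] := hS; have subN := Ssub 2 isT.
have ab (x y : G) : S 2 [~ x, y]%g.
  by have /(abelian_factorP _ subN) := Sab 1 isT; rewrite S1; apply.
have [H [j [T [j_inj hT solH]]]] := IH _ _ (subgroup_series subN hS erefl).
have [B [f [fM fN f_surj]]] := abelian_quotient subN ab.
(* The series has length n + 2, so its first factor is not the last one and is torsion-free. *)
have tfB : torsion_free B.
  move=> m b m0; have [x <-] := f_surj b.
  have f1 : f 1%g = 0 by apply/fN; have [] := subN.
  have -> : f x *+ m = f (x ^+ m)%g.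
    by elim: m {m0} => [|m IHm]; rewrite ?mulr0n ?f1 // expgS fM mulrS IHm.
  move=> /fN xm; apply/fN; have := Stf 1 isT.
  by move/(torsion_free_factorP _ subN)/(_ x m); apply => //; rewrite S1.
have [ev ev_inj] := eval_embedding (torsion_free_separated tfB).
pose V : zmodType := (B -> rat) -> rat.
have divV : divisible V by apply/divisible_fun/divisible_rat.
have tfV : torsion_free V by apply/torsion_free_fun/torsion_free_rat.
have [iota iota_inj] : exists iota : {hom G -> wreath H V}, injective iota.
  apply: (@kaloujnine_krasner _ H V (S 2) (ev \o f) (j \o to_subgroup subN)) => /=.
  - by move=> x y; rewrite fM raddfD.
  - move=> x /=; apply: (iff_trans _ (fN x)); split=> [|->]; last exact: raddf0.
    by rewrite -(raddf0 ev); apply: ev_inj.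
  - by move=> x y Nx Ny; rewrite to_subgroupM // gmulfM.
  - move=> x Nx; rewrite -[RHS](@gmulf1 _ _ j) => /j_inj /(congr1 \val).
    by rewrite to_subgroupK // subgroup_val1.
exists (wreath H V), iota.
exists (fun i => if (i <= 1)%N then setT else wreath_base (V := V) (T i.-1)).
split=> //; first exact: wreath_series.
exact: wreath_all_solvable_torsion_free.
Qed.

(** * Changing the coefficient group of a system *)

Section ChangeCoefficients.
Variables (G K : groupType) (phi : {hom G -> K}) (I : choiceType).

Definition fp_map : freeprod G I -> freeprod K I :=
  fp_subst (@fp_const K I \o phi : {hom G -> freeprod K I}) (@fp_var K I).

HB.instance Definition _ := UMagmaMorphism.on fp_map.

Lemma fp_expsum_map p : fp_expsum (fp_map p) = fp_expsum p.
Proof.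
rewrite -[p]reprK /fp_map fp_substE fp_expsumE /word_val /word_expsum.
elim: (repr p) => [|l u IHu]; first by rewrite !big_nil fp_expsum1.
rewrite !big_cons fp_expsumM IHu; congr (_ + _).
case: l => [g|[i e]] /=; first by rewrite fp_expsum_const.
have <- := fp_pi_var K i e; rewrite fp_expsumE /word_expsum big_seq1 //.
Qed.

Lemma fp_subst_map (x : I -> K) p :
  fp_subst (idfun : {hom K -> K}) x (fp_map p) = fp_subst phi x p.
Proof.
apply: (@fp_subst_unique _ _ _ phi x
  (fp_subst (idfun : {hom K -> K}) x \o fp_map : {hom _ -> K})) => [g|i] /=.
  by rewrite /fp_map fp_subst_const /= fp_subst_const.
by rewrite /fp_map !fp_subst_var.
Qed.

End ChangeCoefficients.

Theorem mainTheorem3 (n : nat) (hn : (1 <= n)%N)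
    (G : groupType) (S : nat -> set G) (hS : abelian_tf_series n S) :
  exists (Gt : groupType) (iota : {hom G -> Gt}) (St : nat -> set Gt),
    [/\ injective iota,
        abelian_tf_series n St,
        forall (I J : choiceType) (w : J -> freeprod G I),
          nonsingular w -> has_solution iota w
      & forall (I J : choiceType) (w : J -> freeprod Gt I),
          nonsingular w -> has_solution (idfun : {hom Gt -> Gt}) w].
Proof.
case: n hn hS => // n _ /embedding [Gt [iota [St [iota_inj hSt sol]]]].
exists Gt, iota, St; split=> // I J w w_ind.
(* A system over [G] is pushed forward to one over [Gt]: the exponent rows do not change, so it
   stays non-singular, and its solutions solve the original system. *)
have [|x xP] := sol I J (fun j => fp_map iota (w j)).
  by move=> s c us s0; apply: w_ind us _; rewrite -[RHS]s0;
    apply: eq_bigr => j _; rewrite fp_expsum_map.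
by exists x => j; rewrite -(xP j) fp_subst_map.
Qed.
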